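(* Let $(X,d)$ be a nonempty ultrametric space and let $D(X)=D(X,d)$ be the distance set of $(X,d)$. Then the following conditions are equivalent: (i) There is $a\in(0,\infty)$ such that $(0,a]$ or $[a,\infty)$ is a connected component of $\mathbb{R}^{+}\setminus D(X)$. (ii) There is an ultrametric space $(Z,\delta)$ such that $(Z,\delta)$ and $(X,d)$ are weakly similar, but for every weak similarity $\Phi\colon Z\to X$ of $(Z,\delta)$ and $(X,d)$ with scaling function $\psi\colon D(X)\to D(Z)$, and for every ultrametric preserving function $g\colon\mathbb{R}^{+}\to\mathbb{R}^{+}$, one has $g|_{D(X)}\neq\psi$.
   Context: $\mathbb{R}^{+}=[0,\infty)$. An ultrametric on a set $X$ is a metric $d\colon X\times X\to\mathbb{R}^{+}$ satisfying $d(x,y)\le\max\{d(x,z),d(z,y)\}$ for all $x,y,z\in X$. A function $f\colon\mathbb{R}^{+}\to\mathbb{R}^{+}$ is ultrametric preserving if $f\circ d$ is an ultrametric on $X$ for every ultrametric space $(X,d)$. For a metric space $(X,d)$, the distance set is $D(X)=D(X,d)=\{d(x,y)\colon x,y\in X\}$. For nonempty metric spaces $(Z,\delta)$ and $(X,d)$, a mapping $\Phi\colon Z\to X$ is a weak similarity of $(Z,\delta)$ and $(X,d)$ if $\Phi$ is bijective and there is a strictly increasing function $\psi\colon D(X)\to D(Z)$ such that $\delta(x,y)=\psi(d(\Phi(x),\Phi(y)))$ for all $x,y\in Z$. The function $\psi$ is uniquely determined by $\Phi$ and is called the scaling function of $\Phi$; the spaces are then called weakly similar. $\mathbb{R}^{+}\setminus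 D(X)$ carries the subspace topology from $\mathbb{R}$; a component is a maximal connected subset. *)

(* Defs.v *)
From HB Require Import structures.
From mathcomp Require Import all_boot all_order all_algebra.
From mathcomp Require Import all_classical all_reals all_analysis.
Import Order.TTheory GRing.Theory Num.Theory.
Import numFieldNormedType.Exports.

Set Implicit Arguments.
Unset Strict Implicit.
Unset Printing Implicit Defensive.

Local Open Scope classical_set_scope.
Local Open Scope ring_scope.

Section Ultrametrics.
Context {R : realType}.

(* A function between subsets A, B of the line is a function R -> R with
   [set_fun A B]; its values outside A are irrelevant. *)
Definition Rplus : set R := `[0, +oo[.

(* Predicates on distance functions, rather than the bundled [metricType],
   because one type carries several distances (d and its composites f o d). *)
Definition is_metric (X : Type) (d : X -> X -> R) : Prop :=
  [/\ forall x y, Rplus (d x y),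
      forall x y, d x y = 0 <-> x = y,
      forall x y, d x y = d y x
    & forall x y z, d x y <= d x z + d z y].

Definition is_ultrametric (X : Type) (d : X -> X -> R) : Prop :=
  is_metric d /\ forall x y z, d x y <= Num.max (d x z) (d z y).

Definition ultrametric_preserving (f : R -> R) : Prop :=
  set_fun Rplus Rplus f /\
  forall (X : Type) (d : X -> X -> R),
    is_ultrametric d -> is_ultrametric (fun x y => f (d x y)).

Definition distance_set (X : Type) (d : X -> X -> R) : set R :=
  [set t | exists x y, t = d x y].

Definition weak_similarity_scaling (Z X : Type) (delta : Z -> Z -> R)
    (d : X -> X -> R) (Phi : Z -> X) (psi : R -> R) : Prop :=
  [/\ bijective Phi,
      set_fun (distance_set d) (distance_set delta) psi,
      {in distance_set d &, {homo psi : s t / s < t}}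
    & forall x y, delta x y = psi (d (Phi x) (Phi y))].

Definition weak_similarity (Z X : Type) (delta : Z -> Z -> R)
    (d : X -> X -> R) (Phi : Z -> X) : Prop :=
  exists psi, weak_similarity_scaling delta d Phi psi.

Definition weakly_similar (Z X : Type) (delta : Z -> Z -> R)
    (d : X -> X -> R) : Prop :=
  exists Phi, weak_similarity delta d Phi.

End Ultrametrics.

Definition is_component (T : topologicalType) (A C : set T) : Prop :=
  exists2 x, A x & C = connected_component A x.

(* Main.v *)
Require Import Defs.
From mathcomp Require Import all_boot all_order all_algebra.
From mathcomp Require Import all_classical all_reals all_analysis.
Import Order.TTheory GRing.Theory Num.Theory.
Import numFieldNormedType.Exports.

Local Open Scope classical_set_scope.
Local Open Scope ring_scope.

(**
  The ultrametric preserving functions are the nondecreasing functions on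
  [0, oo) that vanish exactly at 0.  A strictly increasing [psi] on
  [D = D(X)] with [psi 0 = 0] extends to such a function unless either [D \ {0}]
  has a positive infimum that it does not attain and [psi] tends to 0 there, or
  [D] has a supremum that it does not attain and [psi] tends to infinity there.
  These two kinds of gaps are the components [(0, a]] and [[a, oo)], and on such
  a gap [t |-> t - a], resp. [t |-> 1/(a - t) - 1/a], is a bad scaling function.
*)

(** * Connected components of subsets of the line *)

Lemma RplusE (R : realType) (x : R) : Rplus x = (0 <= x) :> Prop.
Proof. by rewrite /Rplus /= in_itv /= andbT. Qed.

(** Components of [A] are intervals, so one containing [x] and some [y] outside [I] would contain
    the whole segment between them, including the point [s] missing from [A]. *)
Lemma connected_componentP (R : realType) (A I : set R) (x : R) :
  is_interval I -> I x -> I `<=` A ->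
  (forall y, A y -> ~ I y ->
     exists2 s, ~ A s & (x <= s <= y) || (y <= s <= x)) ->
  connected_component A x = I.
Proof.
move=> itvI Ix IA gap; apply/seteqP; split; last first.
  exact: connected_component_max (iffRL (connected_intervalP I) itvI).
move=> y Cy; apply: contrapT => nIy.
have CA := @connected_component_sub _ A x.
have [s nAs sxy] := gap y (CA _ Cy) nIy.
have itvC : is_interval (connected_component A x).
  by apply/connected_intervalP; exact: component_connected.
have Cx : connected_component A x x.
  by apply: connected_component_refl; exact: IA.
apply/nAs/CA; case/orP: sxy => sxy; [exact: (itvC x y)|exact: (itvC y x)].
Qed.

Lemma interval_sub_component {R : realType} {A C : set R} (i : interval R) {x} :
  is_component A C -> x \in i -> C x -> [set` i] `<=` A -> [set` i] `<=` C.
Proof.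
move=> [z Az ->] xi Cx iA.
rewrite (same_connected_component Cx).
apply: connected_component_max => //.
exact/connected_intervalP/interval_is_interval.
Qed.

(** * The two kinds of gaps, expressed through the points of [D] *)

Section Components.
Context {R : realType} (D : set R) (a : R).
Hypothesis a_gt0 : 0 < a.

(** On the left the component is stopped by the point 0 of [D]; on the right it stops at [a] exactly
    when points of [D] accumulate at [a] from above. *)
Lemma component_oc : D 0 ->
  is_component (Rplus `\` D) `]0, a] <->
  (forall s, D s -> 0 < s -> a < s) /\
  (forall e, a < e -> exists2 s, D s & 0 < s < e).
Proof.
move=> D0; have aI : [set` `]0, a]] a by rewrite /= in_itv /= a_gt0 lexx.
split=> [comp|[Dgt near_a]].
  have sub : `]0, a] `<=` Rplus `\` D.
    by case: comp => x Ax ->; exact: connected_component_sub.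
  split=> [s Ds s0|e ae].
    rewrite ltNge; apply/negP => sa.
    by have [] : (Rplus `\` D) s by apply: sub; rewrite /= in_itv /= s0.
  apply: contrapT => noD.
  (* Without points of [D] in []0, e[], the component would swallow this interval, and with it the
     midpoint of [a] and [e]. *)
  have : [set` `]0, e[] `<=` `]0, a].
    apply: (interval_sub_component _ comp (x := a)) => //.
      by rewrite in_itv /= a_gt0.
    move=> y /=; rewrite in_itv /= => /andP[y0 ye]; split.
      by rewrite RplusE ltW.
    by move=> Dy; apply: noD; exists y => //; rewrite y0.
  move=> /(_ ((a + e) / 2)) /=; rewrite !in_itv /= => mid.
  have [am me] := midf_lt ae.
  have /mid /andP[_] : 0 < (a + e) / 2 < e by rewrite me (lt_trans a_gt0).
  by rewrite leNgt am.
have aA : (Rplus `\` D) a.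
  split; first by rewrite RplusE ltW.
  by move=> /Dgt; rewrite ltxx => /(_ a_gt0).
exists a => //; apply/esym/connected_componentP => //.
- exact: interval_is_interval.
- move=> y /=; rewrite in_itv /= => /andP[y0 ya]; split.
    by rewrite RplusE ltW.
  by move=> /Dgt /(_ y0); rewrite ltNge ya.
move=> y [] /=; rewrite RplusE in_itv /= => y0 nDy /negP.
rewrite negb_and -leNgt -ltNge => /orP[y0'|ay].
  by exfalso; apply: nDy; have -> : y = 0 by apply/le_anti/andP.
have [s Ds /andP[s0 sy]] := near_a _ ay.
exists s; first by case.
by rewrite (ltW (Dgt s Ds s0)) (ltW sy).
Qed.

(** A half-line avoiding [D] cannot be prolonged downwards exactly when [D] comes arbitrarily close
    to [a] from below. *)
Lemma component_cy :
  is_component (Rplus `\` D) `[a, +oo[ <->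
  (forall s, D s -> s < a) /\ (forall e, e < a -> exists2 s, D s & e < s).
Proof.
have aI : [set` `[a, +oo[] a by rewrite /= in_itv /= lexx.
split=> [comp|[Dlt near_a]].
  have sub : `[a, +oo[ `<=` Rplus `\` D.
    by case: comp => x Ax ->; exact: connected_component_sub.
  split=> [s Ds|e ea].
    rewrite ltNge; apply/negP => sa.
    by have [] : (Rplus `\` D) s by apply: sub; rewrite /= in_itv /= sa.
  apply: contrapT => noD.
  (* [e] may be negative; cutting at 0 keeps the larger interval inside [Rplus]. *)
  have m_lt : Num.max e 0 < a by rewrite gt_max ea.
  have : [set` `]Num.max e 0, +oo[] `<=` `[a, +oo[.
    apply: (interval_sub_component _ comp (x := a)) => //.
      by rewrite in_itv /= andbT.
    move=> y /=; rewrite in_itv /= andbT gt_max => /andP[ey y0]; split.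
      by rewrite RplusE ltW.
    by move=> Dy; apply: noD; exists y.
  move=> /(_ ((Num.max e 0 + a) / 2)) /=; rewrite !in_itv /= !andbT => mid.
  have [/mid] := midf_lt m_lt.
  by rewrite leNgt => /negP.
have aA : (Rplus `\` D) a.
  split; first by rewrite RplusE ltW.
  by move=> /Dlt; rewrite ltxx.
exists a => //; apply/esym/connected_componentP => //.
- exact: interval_is_interval.
- move=> y /=; rewrite in_itv /= andbT => ay; split.
    by rewrite RplusE (le_trans (ltW a_gt0)).
  by move=> /Dlt; rewrite ltNge ay.
move=> y [] /=; rewrite RplusE in_itv /= andbT => y0 nDy /negP.
rewrite -ltNge => ya.
have [s Ds ys] := near_a _ ya.
exists s; first by case.
by rewrite (ltW ys) (ltW (Dlt s Ds)) orbT.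
Qed.

End Components.

(** * Distance sets and composites of ultrametrics *)

Section DistanceSet.
Context {R : realType} {X : Type} {d : X -> X -> R}.
Hypothesis d_ultra : is_ultrametric d.

Lemma dist_in x y : distance_set d (d x y).
Proof. by exists x, y. Qed.

Lemma ultra_ge0 x y : 0 <= d x y.
Proof. by have [[+ _ _ _] _] := d_ultra => /(_ x y); rewrite RplusE. Qed.

Lemma ultra_eq0 x y : d x y = 0 <-> x = y.
Proof. by have [[_ + _ _] _] := d_ultra. Qed.

Lemma ultra_xx x : d x x = 0.
Proof. exact/ultra_eq0. Qed.

Lemma distance_set_ge0 s : distance_set d s -> 0 <= s.
Proof. by move=> [x [y ->]]; exact: ultra_ge0. Qed.

Lemma distance_set0 : inhabited X -> distance_set d 0.
Proof. by move=> [x]; exists x, x; rewrite ultra_xx. Qed.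

(** Monotonicity transports the strong triangle inequality, which implies the ordinary one for
    nonnegative terms. The conditions bear on the distance set only, so that scaling functions are
    covered too. *)
Lemma ultrametric_comp (f : R -> R) :
  f 0 = 0 -> (forall s, distance_set d s -> 0 < s -> 0 < f s) ->
  {in distance_set d &, {homo f : s t / s <= t}} ->
  is_ultrametric (fun x y => f (d x y)).
Proof.
move=> f0 fpos fmono.
have [[_ _ d_sym _] d_max] := d_ultra.
have f_ge0 x y : 0 <= f (d x y).
  have [->|dN0] := eqVneq (d x y) 0; first by rewrite f0.
  by apply/ltW/fpos; rewrite ?lt_def ?dN0 ?ultra_ge0 //; exact: dist_in.
have f_max x y z : f (d x y) <= Num.max (f (d x z)) (f (d z y)).
  rewrite le_max; have := d_max x y z; rewrite le_max => /orP[] le_d.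
    by rewrite fmono // inE; exact: dist_in.
  by rewrite orbC fmono // inE; exact: dist_in.
split=> //; split=> [x y|x y|x y|x y z].
- by rewrite RplusE.
- split=> [fd0|->]; last by rewrite ultra_xx f0.
  apply/ultra_eq0/eqP; apply: contra_eqT fd0 => dN0.
  by apply/lt0r_neq0/fpos; rewrite ?lt_def ?dN0 ?ultra_ge0 //; exact: dist_in.
- by rewrite d_sym.
- by apply: le_trans (f_max x y z) _; rewrite ge_max lerDl lerDr !f_ge0.
Qed.

End DistanceSet.

(** * Characterization of ultrametric preserving functions *)

Section UltrametricPreserving.
Context {R : realType} {f : R -> R}.

(** The triangle with apex [None], base [s] and legs [t]. *)
Definition isosceles (s t : R) (x y : option bool) : R :=
  if x == y then 0 else if isSome x && isSome y then s else t.

Lemma isosceles_ultrametric s t :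
  0 < s -> s <= t -> is_ultrametric (isosceles s t).
Proof.
move=> s0 st; have t0 := lt_le_trans s0 st.
have max_iso x y z :
    isosceles s t x y <= Num.max (isosceles s t x z) (isosceles s t z y).
  rewrite le_max /isosceles; move: x y z => [[]|] [[]|] [[]|] /=;
    by rewrite ?lexx ?st ?(ltW s0) ?(ltW t0) ?orbT.
have iso_ge0 x y : 0 <= isosceles s t x y.
  by rewrite /isosceles; case: eqP => // _; case: ifP => _; rewrite ltW.
split=> //; split=> [x y|x y|x y|x y z].
- by rewrite RplusE.
- split=> [|->]; last by rewrite /isosceles eqxx.
  by rewrite /isosceles; case: eqP => // _; case: ifP => _ E; move: s0 t0;
    rewrite E ltxx.
- by rewrite /isosceles eq_sym andbC.
- by apply: le_trans (max_iso x y z) _; rewrite ge_max lerDl lerDr !iso_ge0.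
Qed.

(** Isosceles triangles suffice as test spaces: the strong inequality for the base, taken through
    the apex, is monotonicity of [f]. *)
Lemma ultrametric_preservingP :
  ultrametric_preserving f <->
  [/\ f 0 = 0, forall t, 0 < t -> 0 < f t &
      forall s t, 0 <= s -> s <= t -> f s <= f t].
Proof.
split=> [[_ f_pres]|[f0 fpos fmono]]; last first.
  split=> [t|X d d_ultra].
    by rewrite !RplusE -{2}f0; exact: fmono.
  apply: ultrametric_comp => // [s _|s t]; first exact: fpos.
  by rewrite !inE => /(distance_set_ge0 d_ultra) s0 _; exact: fmono.
have f_ultra s t (s0 : 0 < s) (st : s <= t) :=
  f_pres _ _ (isosceles_ultrametric s t s0 st).
have f0 : f 0 = 0 by exact: (ultra_xx (f_ultra 1 1 ltr01 (lexx 1)) None).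
have fpos t : 0 < t -> 0 < f t.
  move=> t0; have tU := f_ultra t t t0 (lexx t).
  rewrite lt_def (ultra_ge0 tU None (Some true)) andbT.
  by apply/eqP => /(ultra_eq0 tU None (Some true)).
(* A base of length 0 gives no triangle, so [s = 0] is treated apart. *)
split=> // s t; rewrite le_eqVlt => /predU1P[<- |s0 st].
  by rewrite le_eqVlt f0 => /predU1P[<-|/fpos/ltW//]; rewrite f0.
have [_ /(_ (Some true) (Some false) None)] := f_ultra s t s0 st.
by rewrite /isosceles /= maxxx.
Qed.

End UltrametricPreserving.

(** * Extending a scaling function when there are no gaps *)

Section Extension.
Context {R : realType} {D : set R}.
Hypothesis D_ge0 : forall s, D s -> 0 <= s.
Hypothesis D0 : D 0.
Context {s1 : R}.
Hypotheses (Ds1 : D s1) (s1_gt0 : 0 < s1).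

(** The point [u] will keep the extension positive at [t], with [psi u] as a lower bound. When no
    positive point of [D] is at most [t], the infimum of the positive points serves; were it not
    attained, it would bound a gap. *)
Lemma no_gap_at0 :
  (forall a, 0 < a -> ~ is_component (Rplus `\` D) `]0, a]) ->
  forall t, 0 < t -> exists u, [/\ D u, 0 < u & forall s, D s -> t <= s -> u <= s].
Proof.
move=> nocomp t t0.
have [[u [Du u0 ut]]|small] := pselect (exists u, [/\ D u, 0 < u & u <= t]).
  by exists u; split=> // s _; exact: le_trans.
pose P := D `&` [set s | 0 < s]; pose m := inf P.
have P0 : P !=set0 by exists s1.
have tP : lbound P t.
  move=> s [Ds s0]; rewrite leNgt; apply/negP => st; apply: small.
  by exists s; rewrite ltW.
have infP : has_inf P by split=> //; exists t.
have m0 : 0 < m by apply: lt_le_trans t0 _; exact: lb_le_inf.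
have mP s : P s -> m <= s by apply: ge_inf; exists t.
have [Dm|nDm] := pselect (D m).
  by exists m; split=> // s Ds ts; apply: mP; split=> //=; exact: lt_le_trans ts.
exfalso; apply: (nocomp m m0); apply/component_oc => //; split=> [s Ds s0|e me].
  have := mP s (conj Ds s0); rewrite le_eqVlt => /predU1P[ms|//].
  by rewrite ms in nDm.
have [|s [Ds s0] se] := inf_adherent (eps := e - m) _ infP.
  by rewrite subr_gt0.
by exists s => //; rewrite s0 /=; move: se; rewrite addrC subrK.
Qed.

(** [h] truncates at the maximum of [D] if there is one and is the identity otherwise. In the latter
    case [D] is unbounded, since an unattained supremum would start a gap. *)
Lemma no_gap_atoo :
  (forall a, 0 < a -> ~ is_component (Rplus `\` D) `[a, +oo[) ->
  exists h : R -> R,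
    [/\ {homo h : s t / s <= t}, forall t, 0 < t -> 0 < h t,
        forall s, D s -> h s = s & forall t, exists2 s, D s & h t <= s].
Proof.
move=> nocomp.
have [[M [DM Mmax]]|nomax] :=
    pselect (exists M, D M /\ forall s, D s -> s <= M).
  have M0 : 0 < M by exact: lt_le_trans (Mmax _ Ds1).
  exists (Num.min M); split=> [s t st|t t0|s Ds|t].
  - by rewrite le_min !ge_min lexx st orbT.
  - by rewrite lt_min M0.
  - by apply/min_idPr/Mmax.
  - by exists M => //; rewrite ge_min lexx.
exists id; split=> // t; apply: contrapT => bounded.
have Dt : ubound D t.
  move=> s Ds; rewrite leNgt; apply/negP => ts; apply: bounded.
  by exists s => //; rewrite ltW.
have supD : has_sup D by split; [exists 0|exists t].
have Dsup s : D s -> s <= sup D by apply: ub_le_sup; exists t.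
have sup0 : 0 < sup D by exact: lt_le_trans (Dsup _ Ds1).
apply: (nocomp _ sup0); apply/component_cy => //; split=> [s Ds|e esup].
  rewrite lt_neqAle Dsup // andbT; apply/eqP => sE.
  by apply: nomax; exists s; split=> // u Du; rewrite sE Dsup.
have [|s Ds es] := sup_adherent (eps := sup D - e) _ supD.
  by rewrite subr_gt0.
by exists s => //; move: es; rewrite opprB addrC subrK.
Qed.

(** The extension takes at [t] the infimum of [psi] over the points of [D] that are at least [h t].
    These sets shrink as [t] grows, which gives monotonicity. *)
Lemma extend_scaling (psi : R -> R) :
  (forall a, 0 < a -> ~ is_component (Rplus `\` D) `]0, a]) ->
  (forall a, 0 < a -> ~ is_component (Rplus `\` D) `[a, +oo[) ->
  psi 0 = 0 -> {in D &, {homo psi : s t / s < t}} ->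
  exists2 g, ultrametric_preserving g & {in D, g =1 psi}.
Proof.
move=> nogap0 nogapoo psi0 psi_lt.
have psi_le s t : D s -> D t -> s <= t -> psi s <= psi t.
  move=> Ds Dt; rewrite le_eqVlt => /predU1P[->//|st].
  by apply/ltW/psi_lt => //; rewrite inE.
have psi_ge0 s : D s -> 0 <= psi s.
  by move=> Ds; rewrite -psi0 psi_le // D_ge0.
(* [h] truncates at the maximum of [D], if any, so that no [E t] is empty,
   whose [inf] would be the junk value 0. *)
have [h [h_le h_gt0 hD h_cof]] := no_gap_atoo nogapoo.
pose E t := psi @` (D `&` [set s | h t <= s]).
have EN0 t : E t !=set0.
  by have [s Ds hts] := h_cof t; exists (psi s), s.
have E_lb t : has_lbound (E t).
  by exists 0 => _ [s [Ds _] <-]; exact: psi_ge0.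
have gE s : D s -> inf (E s) = psi s.
  move=> Ds; apply/le_anti/andP; split.
    by apply: ge_inf (E_lb s) _ _; exists s => //; split=> //=; rewrite hD.
  by apply: lb_le_inf => // _ [t [Dt /= +] <-]; rewrite hD //; exact: psi_le.
exists (fun t => inf (E t)); last by move=> s; rewrite inE; exact: gE.
apply/ultrametric_preservingP; split=> [|t t0|s t s0 st].
- by rewrite gE.
- have [u [Du u0 uP]] := no_gap_at0 nogap0 _ (h_gt0 _ t0).
  apply: (@lt_le_trans _ _ (psi u)).
    by rewrite -psi0; apply: psi_lt; rewrite ?inE.
  by apply: lb_le_inf => // _ [s [Ds hts] <-]; apply: psi_le => //; exact: uP.
- apply: lb_le_inf => // _ [u [Du htu] <-]; apply: ge_inf => //.
  by exists u => //; split=> //=; exact: le_trans (h_le _ _ st) htu.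
Qed.

End Extension.

(** * Rescaling a space by an increasing function *)

Section WeakSimilarity.
Context {R : realType} {X : Type} {d : X -> X -> R}.
Hypothesis d_ultra : is_ultrametric d.

Lemma scaling0 {Z : Type} {delta : Z -> Z -> R} {Phi psi} :
  inhabited X -> is_ultrametric delta ->
  weak_similarity_scaling delta d Phi psi -> psi 0 = 0.
Proof.
move=> [x] delta_ultra [[Psi _ _] _ _ deltaE].
by rewrite -[in LHS](ultra_xx d_ultra (Phi (Psi x))) -deltaE ultra_xx.
Qed.

Lemma rescale_ultrametric (psi : R -> R) :
  inhabited X -> psi 0 = 0 -> {in distance_set d &, {homo psi : s t / s < t}} ->
  is_ultrametric (fun x y => psi (d x y)).
Proof.
move=> X0 psi0 psi_lt; apply: ultrametric_comp => // [s Ds s0|s t Ds Dt].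
  by rewrite -psi0 psi_lt ?inE //; exact: distance_set0.
by rewrite le_eqVlt => /predU1P[->//|st]; exact/ltW/psi_lt.
Qed.

Lemma rescale_weakly_similar (psi : R -> R) :
  {in distance_set d &, {homo psi : s t / s < t}} ->
  weakly_similar (fun x y => psi (d x y)) d.
Proof.
move=> psi_lt; exists id, psi; split=> //; first by exists id.
by move=> _ [x [y ->]]; exists x, y.
Qed.

End WeakSimilarity.

(** * Equivalence of gaps and non-extendable scalings *)

Theorem theorem2p12 (R : realType) (X : Type) (d : X -> X -> R)
    (X_nonempty : inhabited X) (d_ultra : is_ultrametric d) :
  (exists2 a : R, 0 < a &
     is_component (Rplus `\` distance_set d) `]0, a] \/
     is_component (Rplus `\` distance_set d) `[a, +oo[)
  <->
  (exists (Z : Type) (delta : Z -> Z -> R),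
     [/\ is_ultrametric delta,
         weakly_similar delta d
       & forall (Phi : Z -> X) (psi : R -> R),
           weak_similarity_scaling delta d Phi psi ->
           forall g : R -> R, ultrametric_preserving g ->
             ~ {in distance_set d, g =1 psi}]).
Proof.
have D0 := distance_set0 d_ultra X_nonempty.
have D_ge0 := distance_set_ge0 d_ultra.
split=> [[a a0 [/component_oc|/component_cy]]|].
- move=> /(_ a0 D0)[Dgt near_a].
  (* The maximum only serves to make [psi 0 = 0]; at positive distances [psi] is [t - a]. *)
  pose psi t := Num.max 0 (t - a).
  have psi_pos s : 0 < psi s = (a < s) by rewrite lt_max ltxx subr_gt0.
  have psi0 : psi 0 = 0 by apply/max_idPl; rewrite sub0r oppr_le0 ltW.
  have psi_lt : {in distance_set d &, {homo psi : s t / s < t}}.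
    move=> s t; rewrite !inE => Ds Dt st.
    have at_ := Dgt t Dt (le_lt_trans (D_ge0 s Ds) st).
    by rewrite gt_max psi_pos at_ lt_max ltrD2r st orbT.
  exists X, (fun x y => psi (d x y)); split.
  + exact: rescale_ultrametric.
  + exact: rescale_weakly_similar.
  move=> Phi psi' [_ _ _ psiE] g /ultrametric_preservingP[g0 g_pos g_mono] gE.
  (* A distance this close to [a] has [psi] below [g a]. Although [Phi] is arbitrary, the distance
     of the images is positive, hence above [a], and [g] is at least [g a] there. *)
  have [|s [x [y ->]] /andP[d0 d_lt]] := near_a (a + g a).
    by rewrite ltrDl g_pos.
  have psi'E : g (d (Phi x) (Phi y)) = psi (d x y).
    by rewrite psiE gE // inE; exact: dist_in.
  have ad : a < d x y by apply: Dgt => //; exact: dist_in.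
  have Phi_pos : 0 < d (Phi x) (Phi y).
    rewrite lt_def ultra_ge0 // andbT; apply/eqP => dPhi0.
    by move: psi'E; rewrite dPhi0 g0 => /eqP; rewrite lt_eqF // psi_pos.
  have := g_mono _ _ (ltW a0) (ltW (Dgt _ (dist_in _ _) Phi_pos)).
  rewrite psi'E leNgt => /negP; apply.
  by rewrite gt_max g_pos // ltrBlDl.
- move=> /(_ a0)[Dlt near_a].
  pose psi t := (a - t)^-1 - a^-1.
  have psi0 : psi 0 = 0 by rewrite /psi subr0 subrr.
  have psi_lt : {in distance_set d &, {homo psi : s t / s < t}}.
    move=> s t; rewrite !inE => /Dlt sa /Dlt ta st.
    by rewrite ltrD2r ltf_pV2 ?posrE ?subr_gt0 // ltrD2l ltrN2.
  exists X, (fun x y => psi (d x y)); split.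
  + exact: rescale_ultrametric.
  + exact: rescale_weakly_similar.
  move=> Phi psi' [_ _ _ psiE] g /ultrametric_preservingP[g0 g_pos g_mono] gE.
  have c0 : 0 < g a + a^-1 by rewrite addr_gt0 ?g_pos ?invr_gt0.
  (* The bound solves [psi t = g a]: beyond it [psi] exceeds [g a], whereas [g] is at most [g a] on
     all distances, these being below [a]. *)
  have [|s [x [y ->]] d_gt] := near_a (a - (g a + a^-1)^-1).
    by rewrite ltrBlDr ltrDl invr_gt0.
  have psi'E : g (d (Phi x) (Phi y)) = psi (d x y).
    by rewrite psiE gE // inE; exact: dist_in.
  have ad : d x y < a by apply: Dlt; exact: dist_in.
  have := g_mono _ _ (ultra_ge0 d_ultra _ _) (ltW (Dlt _ (dist_in (Phi x) (Phi y)))).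
  rewrite psi'E leNgt => /negP; apply.
  rewrite ltrBrDr -[X in X < _]invrK ltf_pV2 ?posrE ?invr_gt0 ?subr_gt0 //.
  by rewrite ltrBlDl addrC -ltrBlDl.
move=> [Z [delta [delta_ultra [Phi [psi scal]] noext]]].
apply: contrapT => nocomp.
have psi0 := scaling0 d_ultra X_nonempty delta_ultra scal.
have [_ _ psi_lt _] := scal.
suff [g g_pres gE] : exists2 g, ultrametric_preserving g &
    {in distance_set d, g =1 psi} by exact: noext scal g g_pres gE.
(* If 0 is the only distance, the identity already extends [psi]. *)
have [[s1 [Ds1 s1_gt0]]|triv] := pselect (exists s, distance_set d s /\ 0 < s).
  apply: (extend_scaling D_ge0 D0 Ds1 s1_gt0) => // a a0 comp.
    by apply: nocomp; exists a => //; left.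
  by apply: nocomp; exists a => //; right.
exists id; first exact/ultrametric_preservingP.
move=> s; rewrite inE => Ds.
have [->|sN0] := eqVneq s 0; first by rewrite psi0.
by exfalso; apply: triv; exists s; rewrite lt_def sN0 D_ge0.
Qed.
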